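(* Let $X$ be a real Banach space such that $X$ and $X^*$ are uniformly convex. Let $A:X\rightrightarrows X^*$ be a maximal monotone operator. Then for every $x\in D(A)$ and every $v\in X\setminus\{0\}$, $$A(x;v)=\operatorname{Limsup}_{w\to v,\,t\downarrow 0}A(x+tw)=w\text{-}\operatorname{Limsup}_{w\to v,\,t\downarrow 0}A(x+tw).$$
   Context: $X^*$ is the continuous dual of $X$, $\langle\cdot,\cdot\rangle$ the duality pairing, $\to$ denotes strong (norm) convergence and $\rightharpoonup$ weak convergence. For a set-valued operator $A:X\rightrightarrows X^*$, $D(A)=\{x\in X: Ax\neq\emptyset\}$. $A$ is monotone if $\langle x^*-y^*,x-y\rangle\ge 0$ whenever $x^*\in Ax$, $y^*\in Ay$, and maximal monotone if in addition its graph is not properly contained in the graph of another monotone operator. For $K\subset X^*$ nonempty closed convex, the support function is $\sigma_K(v)=\sup\{\langle x^*,v\rangle:x^*\in K\}\in\mathbb{R}\cup\{+\infty\}$, $v\in X$. For $x\in D(A)$ and $v\in X$, $A(x;v):=\{x^*\in Ax:\langle x^*,v\rangle=\sigma_{Ax}(v)\}$ (the face of $Ax$ associated with direction $v$, when $v\ne0$). $\operatorname{Limsup}_{w\to v,\,t\downarrow0}A(x+tw)$ is the set of all $x^*\in X^*$ for which there exist sequences $w_n\to v$ in $X$, $t_n\downarrow 0$ (with $t_n>0$) and $x_n^*\to x^*$ (strongly) with $x_n^*\in A(x+t_nw_n)$ for all $n\in\mathbb{N}$. The set $w\text{-}\operatorname{Limsup}_{w\to v,\,t\downarrow0}A(x+tw)$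 is defined in the same way, with weak convergence $x_n^*\rightharpoonup x^*$ in place of strong convergence $x_n^*\to x^*$ (but still $w_n\to v$ strongly). *)

(* Defs.v *)
From HB Require Import structures.
From mathcomp Require Import all_boot all_order all_algebra.
From mathcomp Require Import all_classical all_reals all_analysis.

Set Implicit Arguments.
Unset Strict Implicit.
Unset Printing Implicit Defensive.

Import Order.TTheory GRing.Theory Num.Theory.
Import numFieldNormedType.Exports.

Local Open Scope classical_set_scope.
Local Open Scope ring_scope.

Section dual_lmodule.
Variables (R : realType) (X : normedModType R).

Definition dual_pred : {pred X -> R^o} :=
  mem [set f : X -> R^o | linear f /\ continuous f].

Lemma dual_pred_submod_closed : submod_closed dual_pred.
Proof.
split=> [|a f g].
  rewrite inE; split=> [b u v /=|x]; first by rewrite scaler0 addr0.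
  exact: cst_continuous.
rewrite !inE => -[lf cf] [lg cg]; split=> [b u v|x].
  by rewrite !fctE lf lg !scalerDr !scalerA mulrC addrACA.
by apply: cvgD; [apply: cvgZl_tmp; exact: cf | exact: cg].
Qed.

HB.instance Definition _ :=
  GRing.isSubmodClosed.Build R (X -> R^o) dual_pred dual_pred_submod_closed.

(* The continuous dual of X; the application f v of f : dual X to v : X is the
   duality pairing <f, v>. *)
Record dual : Type := Dual {
  dual_fun :> X -> R^o ;
  dual_funP : dual_fun \in dual_pred }.

HB.instance Definition _ := [isSub for dual_fun].
HB.instance Definition _ := [Choice of dual by <:].
HB.instance Definition _ := [SubChoice_isSubLmodule of dual by <:].

End dual_lmodule.

Section dual_norm.
Variables (R : realType) (X : normedModType R).
Implicit Types f g : dual X.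

Definition dual_norm f : R := sup [set `|f x| | x in [set x : X | `|x| <= 1]].

Lemma dual_linear f : linear f.
Proof. by case: f => f /=; rewrite inE => -[]. Qed.

Lemma dual_continuous f : continuous f.
Proof. by case: f => f /=; rewrite inE => -[]. Qed.

HB.instance Definition _ f :=
  GRing.isLinear.Build R X R^o _ (f : X -> R^o) (dual_linear f).

Lemma dual_has_sup f : has_sup [set `|f x| | x in [set x : X | `|x| <= 1]].
Proof.
split; first by exists `|f 0|, 0; rewrite //= normr0.
have /bounded_funP/(_ 1)[M fM] :
  bounded_near (f : {linear X -> R^o}) (nbhs (0 : X)).
  by apply/linear_bounded_continuous; exact: dual_continuous.
by exists M => _ [x /= x1 <-]; exact: fM.
Qed.

Lemma dual_norm_ub f x : `|x| <= 1 -> `|f x| <= dual_norm f.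
Proof. by move=> x1; apply: (ub_le_sup (dual_has_sup f).2); exists x. Qed.

Lemma dual_norm_le f (M : R) :
  (forall x, `|x| <= 1 -> `|f x| <= M) -> dual_norm f <= M.
Proof.
move=> fM; apply: ge_sup; first exact: (dual_has_sup f).1.
by move=> _ [x /= x1 <-]; exact: fM.
Qed.

Lemma dual_norm_ge0 f : 0 <= dual_norm f.
Proof.
by rewrite (le_trans (normr_ge0 (f 0)))// dual_norm_ub// normr0.
Qed.

Lemma dual_normD f g : dual_norm (f + g) <= dual_norm f + dual_norm g.
Proof.
apply: dual_norm_le => x x1; rewrite (le_trans (ler_normD (f x) (g x)))//.
by rewrite lerD// dual_norm_ub.
Qed.

Lemma dual_normZ (a : R) f : dual_norm (a *: f) = `|a| * dual_norm f.
Proof.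
have le_normZ (b : R) g : dual_norm (b *: g) <= `|b| * dual_norm g.
  apply: dual_norm_le => x x1; have -> : (b *: g) x = b * g x by [].
  by rewrite normrM ler_wpM2l// dual_norm_ub.
have [->|a0] := eqVneq a 0.
  apply/eqP; rewrite eq_le le_normZ/= normr0 mul0r.
  exact: dual_norm_ge0.
apply/eqP; rewrite eq_le le_normZ/= -ler_pdivlMl ?normr_gt0//.
by have := le_normZ a^-1 (a *: f); rewrite scalerA mulVf// scale1r normfV.
Qed.

Lemma dual_norm_eq0 f : dual_norm f = 0 -> f = 0.
Proof.
move=> f0; apply/val_inj/funext => x /=.
have [->|x0] := eqVneq x 0; first by rewrite linear0.
have /dual_norm_ub : `| (`|x|^-1 *: x) | <= 1.
  by rewrite normrZ normfV normr_id mulVf ?normr_eq0.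
move=> /(_ f); rewrite f0 normr_le0 linearZ/= scaler_eq0.
by rewrite invr_eq0 normr_eq0 (negbTE x0) => /eqP.
Qed.

HB.instance Definition _ :=
  Lmodule_isNormed.Build R (dual X) dual_normD dual_normZ dual_norm_eq0.

End dual_norm.

(* Clarkson's definition. *)
Definition uniformly_convex (R : realType) (V : normedModType R) : Prop :=
  forall e : R, 0 < e <= 2 -> exists2 d : R, 0 < d &
    forall x y : V, `|x| = 1 -> `|y| = 1 -> e <= `|x - y| ->
      `|2^-1 *: (x + y)| <= 1 - d.

(* Used below with V := dual X, where the test functionals f range over the
   bidual dual (dual X): this is weak, not a priori weak-*, convergence. *)
Definition weak_cvg (R : realType) (V : normedModType R)
    (u : nat -> V) (l : V) : Prop :=
  forall f : dual V, f (u n) @[n --> \oo] --> f l.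

Section set_valued_operators.
Variables (R : realType) (X : normedModType R).
Implicit Types (A B : X -> set (dual X)) (K : set (dual X)) (x v : X).

Definition opdom A : set X := [set x | A x !=set0].

Definition opgraph A : set (X * dual X) := [set p | A p.1 p.2].

Definition monotone_op A : Prop :=
  forall x y (xs ys : dual X), A x xs -> A y ys -> 0 <= (xs - ys) (x - y).

Definition maximal_monotone A : Prop :=
  monotone_op A /\ forall B, monotone_op B -> ~ (opgraph A `<` opgraph B).

Definition support_fun K v : \bar R := ereal_sup [set (f v)%:E | f in K].

Definition face A x v : set (dual X) :=
  [set xs | A x xs /\ (xs v)%:E = support_fun (A x) v].

(* t n decreases to 0 in the sense of the limit t -> 0+; the sequence t is not
   required to be monotone (one may always pass to a subsequence). *)
Definition Limsup_op A x v : set (dual X) :=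
  [set xs | exists (w : nat -> X) (t : nat -> R) (xn : nat -> dual X),
    [/\ w n @[n --> \oo] --> v,
        (forall n, 0 < t n) /\ t n @[n --> \oo] --> 0,
        xn n @[n --> \oo] --> xs &
        forall n, A (x + t n *: w n) (xn n)]].

Definition wLimsup_op A x v : set (dual X) :=
  [set xs | exists (w : nat -> X) (t : nat -> R) (xn : nat -> dual X),
    [/\ w n @[n --> \oo] --> v,
        (forall n, 0 < t n) /\ t n @[n --> \oo] --> 0,
        weak_cvg xn xs &
        forall n, A (x + t n *: w n) (xn n)]].

End set_valued_operators.

(* Main.v *)
From HB Require Import structures.
Require Import Defs.
From mathcomp Require Import all_boot all_order all_algebra.
From mathcomp Require Import all_classical all_reals all_analysis.
From mathcomp Require Import ring lra.

Set Implicit Arguments.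
Unset Strict Implicit.
Unset Printing Implicit Defensive.

Import Order.TTheory GRing.Theory Num.Theory.
Import numFieldNormedType.Exports.
Local Open Scope classical_set_scope.
Local Open Scope ring_scope.

(** Weak limits of [A (x + t w)] lie in the face by monotonicity, maximality and
    Banach-Steinhaus. Conversely, given [f] in the face, Minty's theorem applied
    to [y |-> A (x + t (v + y)) - f] yields [(p, g)] with
    [f + g \in A (x + t (v + p))] and [(|p|^2 + |g|^2) / 2 + <g, p> <= 0]. By
    monotonicity against [(x, f)] this becomes [(|p|^2 + |g|^2) / 2 <= <g, v>].
    Any weak-* cluster point [h] of [g] as [t -> 0] has [f + h \in A x], so
    [<h, v> <= 0] because [f] is in the face; hence [p] and [g] tend to [0] in
    norm.

    Minty's theorem is proved without reflexivity or minimax theorems. On a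
    suitable closed convex set [C] of triples [(a, f, r)] the uniformly convex
    cost [(|a|^2 + |f|^2) / 2 - r] attains its minimum, since minimizing sequences
    are Cauchy. The optimality condition at the minimum, read through the
    derivatives of the squared norms of [X] and [X^*], says that the negated
    dual pair is monotonically related to the operator. *)

(** * The Hahn-Banach theorem *)

Section hahn_banach.
Variables (R : realType) (V : lmodType R).
Implicit Types (p q : V -> R) (x y : V).

Definition sublinear q :=
  (forall x y, q (x + y) <= q x + q y) /\
  (forall (t : R) x, 0 < t -> q (t *: x) <= t * q x).

Lemma sublinear0 q : sublinear q -> q 0 = 0.
Proof.
move=> [_ qZ]; have := qZ 2 0 ltac:(lra); have := qZ 2^-1 0 ltac:(lra).
by rewrite !scaler0; lra.
Qed.

Lemma sublinearZ q (t : R) x : sublinear q -> 0 <= t -> q (t *: x) = t * q x.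
Proof.
move=> sq; rewrite le_eqVlt => /predU1P[<-|t0].
  by rewrite scale0r mul0r sublinear0.
apply/eqP; rewrite eq_le sq.2//= -ler_pdivlMl//.
have := sq.2 t^-1 (t *: x); rewrite scalerA mulVf ?gt_eqF// scale1r.
by apply; rewrite invr_gt0.
Qed.

Lemma sublinear_ge q x : sublinear q -> - q (- x) <= q x.
Proof.
by move=> sq; have := sq.1 x (- x); rewrite subrr (sublinear0 sq); lra.
Qed.

Lemma le_inf_add (S T : set R) (c : R) : S !=set0 -> T !=set0 ->
  (forall a b, S a -> T b -> c <= a + b) -> c <= inf S + inf T.
Proof.
move=> S0 T0 H; rewrite -lerBlDr; apply: lb_le_inf => // a Sa.
rewrite lerBlDr -lerBlDl; apply: lb_le_inf => // b Tb.
by rewrite lerBlDl H.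
Qed.

Lemma le_inf_mul (S : set R) (c t : R) : S !=set0 -> 0 < t ->
  (forall a, S a -> c <= t * a) -> c <= t * inf S.
Proof.
move=> S0 t0 H; rewrite -ler_pdivrMl//; apply: lb_le_inf => // a Sa.
by rewrite ler_pdivrMl// H.
Qed.

(** For sublinear [q], the largest sublinear functional below [q] whose value at [- y] is at most
    [- q y]. *)
Definition directional_inf q y x : R :=
  inf [set q (x + t *: y) - t * q y | t in [set t : R | 0 <= t]].

Section directional_inf.
Variables (q : V -> R) (y : V).
Hypothesis sq : sublinear q.

Let S x := [set q (x + t *: y) - t * q y | t in [set t : R | 0 <= t]].

Let S_neq0 x : S x !=set0.
Proof. by exists (q (x + 0 *: y) - 0 * q y), 0 => /=. Qed.

Lemma directional_inf_le x (t : R) : 0 <= t ->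
  directional_inf q y x <= q (x + t *: y) - t * q y.
Proof.
move=> t0; apply: ge_inf; last by exists t.
exists (- q (- x)) => _ [s s0 <-].
have := sq.1 (x + s *: y) (- x).
by rewrite addrAC subrr add0r (sublinearZ _ sq)//; lra.
Qed.

Lemma sublinear_directional_inf : sublinear (directional_inf q y).
Proof.
split=> [x1 x2|t x t0].
  apply: le_inf_add => [||_ _ [t t0 <-] [s s0 <-]]; [exact: S_neq0..|].
  apply: (le_trans (@directional_inf_le _ (t + s) (addr_ge0 t0 s0))).
  by have := sq.1 (x1 + t *: y) (x2 + s *: y); rewrite addrACA -scalerDl; lra.
apply: le_inf_mul => // [|_ [s s0 <-]]; first exact: S_neq0.
apply: (le_trans (@directional_inf_le _ (t * s) (mulr_ge0 (ltW t0) s0))).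
by have := sq.2 t (x + s *: y) t0; rewrite scalerDr scalerA; lra.
Qed.

End directional_inf.

(** Zorn's lemma applies because the pointwise infimum of a nonempty chain is a lower bound:
    sublinearity keeps every member above [- p (- x)]. *)
Lemma minimal_sublinear p : sublinear p ->
  exists q, [/\ sublinear q, (forall x, q x <= p x) &
    forall q', sublinear q' -> (forall x, q' x <= q x) -> q' = q].
Proof.
move=> sp; pose T := {q : V -> R | sublinear q /\ forall x, q x <= p x}.
pose rT (a b : T) := `[< forall x, sval b x <= sval a x >].
have [||||[q [sq qp]] qmin] := @Zorn T rT.
- by move=> a; apply/asboolP.
- move=> a b c /asboolP ab /asboolP bc; apply/asboolP => x.
  exact: le_trans (bc x) (ab x).
- move=> [a ha] [b hb] /asboolP/= ab /asboolP/= ba; apply: eq_exist.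
  by apply/funext => x; apply/eqP; rewrite eq_le ab ba.
- move=> F Ftot; have [F0|/set0P F0] := eqVneq F set0.
    by exists (exist _ p (conj sp (fun=> lexx _))) => s; rewrite F0.
  pose S x := [set sval a x | a in F].
  have S0 x : S x !=set0 by case: F0 => a Fa; exists (sval a x), a.
  have Sle a x : F a -> inf (S x) <= sval a x.
    move=> Fa; apply: ge_inf; last by exists a.
    exists (- p (- x)) => _ [[b [sb bp]] _ <-] /=.
    by apply: (le_trans _ (sublinear_ge x sb)); rewrite lerN2.
  have sS : sublinear (fun x => inf (S x)).
    split=> [x y|t x t0].
      apply: le_inf_add => // _ _ [a Fa <-] [b Fb <-].
      (* The smaller of the two chain members serves at both points. *)
      have [/asboolP/(_ x) ab|/asboolP/(_ y) ba] := Ftot _ _ Fa Fb.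
        apply: (le_trans (Sle _ _ Fb)).
        by apply: (le_trans ((svalP b).1.1 x y)); rewrite lerD2r.
      apply: (le_trans (Sle _ _ Fa)).
      by apply: (le_trans ((svalP a).1.1 x y)); rewrite lerD2l.
    apply: le_inf_mul => // _ [a Fa <-].
    by apply: (le_trans (Sle _ _ Fa)); exact: (svalP a).1.2.
  have Sp x : inf (S x) <= p x.
    by case: F0 => a Fa; apply: (le_trans (Sle _ _ Fa)); exact: (svalP a).2.
  exists (exist _ (fun x => inf (S x)) (conj sS Sp)) => a Fa.
  by apply/asboolP => x /=; exact: Sle.
exists q; split=> // q' sq' q'q.
have q'p x : q' x <= p x by exact: le_trans (q'q x) (qp x).
have /qmin : rT (exist _ q (conj sq qp)) (exist _ q' (conj sq' q'p)).
  exact/asboolP.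
by move=> /(congr1 sval).
Qed.

(* A minimal sublinear functional q is odd, because q lies below its own
   directional infimum along y, whose value at - y is at most - q y. *)
Theorem hahn_banach p : sublinear p -> exists q : V -> R,
  [/\ forall x y, q (x + y) = q x + q y, forall a x, q (a *: x) = a * q x &
      forall x, q x <= p x].
Proof.
move=> /minimal_sublinear[q [sq qp qmin]]; exists q.
have qN y : q (- y) = - q y.
  have qdir : directional_inf q y = q.
    apply: qmin => [|x]; first exact: sublinear_directional_inf.
    have := directional_inf_le y sq x (lexx 0).
    by rewrite scale0r addr0 mul0r subr0.
  have := directional_inf_le y sq (- y) ler01.
  rewrite qdir scale1r addNr (sublinear0 sq) mul1r.
  by have := sublinear_ge y sq; lra.
split=> // [x y|a x].
  have := sq.1 x y; have := sq.1 (x + y) (- y).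
  by rewrite addrK qN; lra.
have [a0|/ltW a0] := leP 0 a; first exact: sublinearZ.
have := @sublinearZ q (- a) x sq; rewrite oppr_ge0 scaleNr qN => /(_ a0); lra.
Qed.

End hahn_banach.

(** * The dual space *)

Section dual_pairing.
Variables (R : realType) (X : normedModType R).
Implicit Types (f g : dual X) (x y : X).

Lemma ler_dual_norm f x : `|f x| <= `|f| * `|x|.
Proof.
have [->|x0] := eqVneq x 0; first by rewrite linear0 !normr0 mulr0.
have nx : 0 < `|x| by rewrite normr_gt0.
have /(dual_norm_ub f) : `| (`|x|^-1 *: x) | <= 1.
  by rewrite normrZ normfV normr_id mulVf ?gt_eqF.
rewrite linearZ normrZ normfV normr_id.
by rewrite ler_pdivrMl// mulrC.
Qed.

Lemma ler_dual f x : f x <= `|f| * `|x|.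
Proof. by rewrite (le_trans (ler_norm _))// ler_dual_norm. Qed.

Lemma ger_dual f x : - (`|f| * `|x|) <= f x.
Proof. by have := ler_dual_norm f x; rewrite ler_norml => /andP[]. Qed.

Lemma dual_of_bounded (h : X -> R) (C : R) :
  (forall x y, h (x + y) = h x + h y) -> (forall a x, h (a *: x) = a * h x) ->
  (forall x, `|h x| <= C * `|x|) ->
  exists2 f : dual X, (f : X -> R) = h & `|f| <= `|C|.
Proof.
move=> hD hZ hC.
have lh : linear (h : X -> R^o) by move=> a u v; rewrite hD hZ.
have ch : continuous (h : X -> R^o).
  pose L := GRing.isLinear.Build R X R^o _ (h : X -> R^o) lh.
  pose H : {linear X -> R^o} := HB.pack (h : X -> R^o) L.
  apply: (proj1 (@linear_bounded_continuous R X R^o H)).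
  apply/bounded_funP => r; exists (`|C| * `|r|) => x xr.
  rewrite (le_trans (hC x))// (le_trans (ler_norm _))// normrM normr_id.
  by rewrite ler_wpM2l// (le_trans xr)// ler_norm.
have hP : (h : X -> R^o) \in @dual_pred R X by rewrite inE.
exists (Dual hP) => //.
apply: dual_norm_le => x x1 /=; rewrite (le_trans (hC x))//.
rewrite (le_trans (ler_norm _))// normrM normr_id ler_piMr//.
Qed.

Lemma dual_addE f g x : (f + g) x = f x + g x :> R. Proof. by []. Qed.
Lemma dual_oppE f x : (- f) x = - f x :> R. Proof. by []. Qed.
Lemma dual_scaleE (a : R) f x : (a *: f) x = a * f x :> R. Proof. by []. Qed.
Lemma dualD f x y : f (x + y) = f x + f y :> R. Proof. exact: linearD. Qed.
Lemma dualN f x : f (- x) = - f x :> R. Proof. exact: linearN. Qed.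
Lemma dualZ (a : R) f x : f (a *: x) = a * f x :> R. Proof. exact: linearZ. Qed.
Definition dualE := (dual_addE, dual_oppE, dual_scaleE, dualD, dualN, dualZ).

End dual_pairing.

Section norming_functional.
Variables (R : realType) (X : normedModType R).

(** Hahn-Banach is applied to the directional infimum along [x] of y |-> |x| |y|, rather than to
    this function itself; this forces the value |x|^2 at [x]. *)
Lemma norming_functional (x : X) :
  exists f : dual X, f x = `|x| ^+ 2 :> R /\ `|f| = `|x|.
Proof.
have sn : sublinear (fun y : X => `|x| * `|y|).
  split=> [y z|t y t0]; first by rewrite -mulrDr ler_wpM2l// ler_normD.
  by rewrite normrZ gtr0_norm// mulrCA.
have [q [qD qZ qle]] := hahn_banach (sublinear_directional_inf x sn).
have qn y : q y <= `|x| * `|y|.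
  apply: (le_trans (qle y)); have := directional_inf_le x sn y (lexx 0).
  by rewrite scale0r addr0 mul0r subr0.
have qN y : q (- y) = - q y by rewrite -scaleN1r qZ mulN1r.
have qabs y : `|q y| <= `|x| * `|y|.
  by rewrite ler_norml qn andbT lerNl -qN -[`|y|]normrN qn.
have [f fq] := dual_of_bounded qD qZ qabs.
rewrite normr_id => nf.
have qx : `|x| ^+ 2 <= q x.
  have := directional_inf_le x sn (- x) ler01.
  rewrite scale1r addNr normr0 mulr0 mul1r sub0r -expr2.
  by have := qle (- x); rewrite qN; lra.
exists f; have fx : f x = `|x| ^+ 2 :> R.
  rewrite fq; apply/eqP; rewrite eq_le qx andbT expr2; exact: qn.
split=> //; apply/eqP; rewrite eq_le nf /=.
have [->|x0] := eqVneq x 0; first by rewrite normr0.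
have := ler_dual f x; rewrite fx expr2 ler_pM2r// normr_gt0//.
Qed.

End norming_functional.

(** Completeness is a predicate so that [quadratic_minimum] can treat [X] and [dual X] alike. *)
Definition cauchy_cvg_seq (R : realType) (V : normedModType R) : Prop :=
  forall u : nat -> V,
    (forall e : R, 0 < e -> exists N, forall n m, (N <= n)%N -> (N <= m)%N ->
       `|u n - u m| < e) ->
  exists l : V, u n @[n --> \oo] --> l.

Lemma complete_cauchy_cvg (R : realType) (V : completeNormedModType R) :
  cauchy_cvg_seq V.
Proof.
move=> u ucauchy; apply/cvg_ex/cauchy_cvgP/cauchy_exP => e e0.
have [N uN] := ucauchy e e0.
exists (u N), N => // n /= Nn; rewrite -ball_normE/=; exact: uN.
Qed.

Lemma ultra_fmap (S T : Type) (f : S -> T) (U : set_system S) :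
  UltraFilter U -> UltraFilter (f @ U).
Proof.
move=> UU; split; first exact: fmap_proper_filter.
move=> G PG sUG; apply/seteqP; split=> // B GB.
have [//|UCB] := in_ultra_setVsetC (f @^-1` B) UU.
have GCB : G (~` B) by apply: sUG.
case: (@filter_not_empty _ _ PG); rewrite -(setICr B).
exact: filterI.
Qed.

(** * Weak-* compactness and completeness of the dual space *)

Section weak_star.
Variables (R : realType) (X : normedModType R).

(** Banach-Alaoglu along an ultrafilter [U] refining [F]: each scalar sequence [u n x] stays in a
    compact segment, hence converges along [U], and the limits inherit linearity and the bound. *)
Lemma weak_star_cluster (F : set_system nat) (u : nat -> dual X) (K : R) :
  ProperFilter F -> (forall n, `|u n| <= K) ->
  exists (U : set_system nat) (f : dual X), [/\ ProperFilter U, F `<=` U &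
    forall x, (u n x : R) @[n --> U] --> (f x : R)].
Proof.
move=> FF uK; have [U [UU FU]] := ultraFilterLemma FF.
have PU : ProperFilter U := @ultra_proper _ _ UU.
have lim_ex x : exists l : R, (u n x : R) @[n --> U] --> l.
  have := @segment_compact R (- (K * `|x|)) (K * `|x|).
  rewrite compact_ultra => /(_ ((fun n => u n x : R) @ U)).
  case=> [||l [_ ul]]; last by exists l.
    exact: ultra_fmap.
    apply: (@filterE _ U) => n /=; rewrite in_itv/=.
    have := ler_dual_norm (u n) x; rewrite ler_norml => /andP[].
    have : `|u n| * `|x| <= K * `|x| by rewrite ler_wpM2r.
    move=> *; apply/andP; split; lra.
have [h hE] := choice lim_ex.
have [x y|a x|x|f fh _] := @dual_of_bounded R X h K.
- have cvD : (u n (x + y) : R) @[n --> U] --> h x + h y.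
    rewrite (_ : (fun n => _) = fun n => (u n x : R) + (u n y : R)).
      by apply: cvgD.
    by apply/funext => n; rewrite dualD.
  exact: (@cvg_unique _ (@Rhausdorff R) _ (fmap_proper_filter _ PU)) (hE _) cvD.
- have cvZ : (u n (a *: x) : R) @[n --> U] --> a * h x.
    rewrite (_ : (fun n => _) = fun n => a * (u n x : R)).
      by apply: cvgMl_tmp.
    by apply/funext => n; rewrite dualZ.
  exact: (@cvg_unique _ (@Rhausdorff R) _ (fmap_proper_filter _ PU)) (hE _) cvZ.
- apply: (cvgr_to_le (cvg_norm (hE x))).
  apply: filterE => n; apply: (le_trans (ler_dual_norm _ _)).
  by rewrite ler_wpM2r.
by exists U, f; split=> // x; rewrite fh.
Qed.

(** A Cauchy sequence is bounded, so it has a weak-* limit along a finer filter; the Cauchy estimate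
    at each point of the unit ball passes to this limit. *)
Lemma dual_cauchy_cvg : cauchy_cvg_seq (dual X).
Proof.
move=> u ucauchy.
have [K uK] : exists K, forall n, `|u n| <= K.
  have [N uN] := ucauchy 1 ltr01.
  exists (1 + \sum_(i < N.+1) `|u i|) => n.
  have le_sum k : (k <= N)%N -> `|u k| <= \sum_(i < N.+1) `|u i|.
    rewrite -ltnS => kN; rewrite (bigD1 (Ordinal kN))//= lerDl.
    exact: sumr_ge0.
  have [nN|/ltnW Nn] := leqP n N.
    by have := le_sum _ nN; lra.
  have := le_sum _ (leqnn N); have := uN n N Nn (leqnn N).
  by have := ler_normD (u n - u N) (u N); rewrite subrK; lra.
have [U [f [PU ooU fU]]] := weak_star_cluster eventually_filter uK.
exists f; apply/cvgrPdist_le => e e0.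
have [N uN] := ucauchy e e0; exists N => // n /= Nn.
apply: dual_norm_le => x x1.
have cv : (u m x - u n x : R) @[m --> U] --> (f x - u n x : R).
  by apply: cvgB => //; exact: cvg_cst.
apply: (cvgr_to_le (cvg_norm cv)); apply: ooU; exists N => // m /= Nm.
rewrite -dual_oppE -dual_addE (le_trans (ler_dual_norm _ _))//.
have := uN m n Nm Nn; have := normr_ge0 (u m - u n); have := normr_ge0 x.
by nra.
Qed.

End weak_star.

(** * Uniform convexity *)

Section uniform_convexity.
Variables (R : realType) (V : normedModType R).
Implicit Types x y : V.

(** The midpoint-convexity defect of the squared norm; in a Hilbert space it is |x - y|^2 / 4. *)
Definition sqnorm_gap x y : R :=
  (`|x| ^+ 2 + `|y| ^+ 2) / 2 - `|2^-1 *: (x + y)| ^+ 2.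

Lemma norm_mid_le x y : `|2^-1 *: (x + y)| <= (`|x| + `|y|) / 2.
Proof.
rewrite normrZ gtr0_norm; last by lra.
by have := ler_normD x y; lra.
Qed.

Lemma sqnorm_gap_ge x y : (`|x| - `|y|) ^+ 2 / 4 <= sqnorm_gap x y.
Proof.
have := norm_mid_le x y; rewrite /sqnorm_gap.
by have := normr_ge0 (2^-1 *: (x + y)); nra.
Qed.

Lemma sqnorm_gap_ge0 x y : 0 <= sqnorm_gap x y.
Proof. by apply: le_trans (sqnorm_gap_ge x y); rewrite divr_ge0// sqr_ge0. Qed.

(** A small defect makes the two norms close. Unless [x] is near 0, Clarkson's condition for the
    normalized vectors then turns a large |x - y| into a large defect. *)
Lemma uniformly_convex_sqnorm (M e : R) : uniformly_convex V -> 0 < e ->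
  exists2 d : R, 0 < d &
    forall x y, `|x| <= M -> sqnorm_gap x y < d -> `|x - y| < e.
Proof.
(* The maximum with [e] makes [M'] positive and [e / (2 * M')] admissible in Clarkson's
   condition. *)
move=> ucV e0; pose M' := Num.max M e.
have M'0 : 0 < M' by rewrite lt_max e0 orbT.
have /ucV[c c0 Hc] : 0 < e / (2 * M') <= 2.
  rewrite divr_gt0 ?mulr_gt0//= ler_pdivrMr ?mulr_gt0//.
  have : e <= M' by rewrite le_max lexx orbT.
  by lra.
(* [tau] bounds the difference of the norms: [e / 4] keeps both away from 0, [e * c / 8] keeps it
   below |x| c / 2. The second term of [d] lies below the defect |x|^2 c / 4 found at the end. *)
pose tau := Num.min (e / 4) (e * c / 8).
have tau0 : 0 < tau by rewrite lt_min !divr_gt0// mulr_gt0.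
pose d := Num.min (tau ^+ 2 / 4) ((e / 4) ^+ 2 * c / 4).
exists d.
  by rewrite lt_min !divr_gt0 ?exprn_gt0 ?mulr_gt0 ?exprn_gt0 ?divr_gt0.
move=> x y xM; rewrite lt_min => /andP[gap1 gap2].
have ab : `| `|x| - `|y| | < tau.
  rewrite -(ltr_pXn2r (_ : 0 < 2)%N) ?nnegrE// ?(ltW tau0)//.
  rewrite real_normK ?num_real//.
  by have := sqnorm_gap_ge x y; lra.
have [tau1 tau2] : tau <= e / 4 /\ tau <= e * c / 8.
  by split; rewrite ge_min lexx ?orbT.
rewrite ltNge; apply/negP => exy.
have [xe|xe] := ltP `|x| (e / 4).
  have := ler_normB x y; move: ab; rewrite ltr_norml => /andP[].
  by lra.
have x0 : 0 < `|x| by lra.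
have y0 : 0 < `|y|.
  by move: ab; rewrite ltr_norml => /andP[]; lra.
pose x1 := `|x|^-1 *: x; pose y1 := `|y|^-1 *: y.
have nx1 : `|x1| = 1 by rewrite normrZ normfV normr_id mulVf// gt_eqF.
have ny1 : `|y1| = 1 by rewrite normrZ normfV normr_id mulVf// gt_eqF.
have xE : x = `|x| *: x1 by rewrite scalerA mulfV ?gt_eqF// scale1r.
have yE : y = `|x| *: y1 - (`|x| - `|y|) *: y1.
  by rewrite -scalerBl opprB addrC subrK scalerA mulfV ?gt_eqF// scale1r.
have xM' : `|x| <= M' by rewrite le_max xM.
(* Replacing [y] by |x| y1 costs less than [tau], so the unit vectors stay far apart. *)
have exy1 : e / (2 * M') <= `|x1 - y1|.
  have : `|x - y| <= `|x| * `|x1 - y1| + tau.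
    rewrite {1}xE {1}yE opprB addrCA addrC -scalerBr.
    apply: (le_trans (ler_normD _ _)); rewrite normrZ normr_id lerD2l//.
    by rewrite normrZ ny1 mulr1 ltW.
  rewrite ler_pdivrMr ?mulr_gt0//.
  have : `|x| * `|x1 - y1| <= M' * `|x1 - y1| by rewrite ler_wpM2r.
  by lra.
have mid : `|2^-1 *: (x + y)| <= `|x| * (1 - c) + `| `|x| - `|y| | / 2.
  rewrite {1}xE {1}yE addrA -scalerDr scalerBr scalerA mulrC -scalerA.
  apply: (le_trans (ler_normB _ _)); rewrite normrZ normr_id lerD//.
    by rewrite ler_wpM2l// Hc.
  rewrite scalerA normrZ ny1 mulr1 normrM gtr0_norm; last by lra.
  by rewrite mulrC.
set m := `|_ *: _| in mid; have m0 : 0 <= m by exact: normr_ge0.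
move: gap2; rewrite /sqnorm_gap -/m.
have xc : e / 4 * c <= `|x| * c by rewrite ler_wpM2r// ltW.
have {}ab : `| `|x| - `|y| | < `|x| * c / 2 by lra.
move: ab mid; set a := `|x| in x0 xe xc *; set b := `|y| in y0 *.
move=> ab mid.
have abl : - `|a - b| <= a - b <= `|a - b| by rewrite -ler_norml.
have H1 : a * c / 2 <= (a + b) / 2 - m by lra.
(* The defect is at least ((a + b) / 2)^2 - m^2, bounded below here factor by factor. *)
have H2 : (a * c / 2) * (a / 2) <= ((a + b) / 2 - m) * ((a + b) / 2 + m).
  apply: ler_pM => //; [|by rewrite divr_ge0// ltW|lra].
  by rewrite divr_ge0// mulr_ge0// ltW.
have H3 : (e / 4) ^+ 2 * c <= a ^+ 2 * c.
  by rewrite ler_wpM2r ?(ltW c0)// lerXn2r ?nnegrE//; lra.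
have := sqr_ge0 (a - b).
by nra.
Qed.

End uniform_convexity.

Lemma sqnorm_gap_cauchy (R : realType) (V : normedModType R) (u : nat -> V) :
  uniformly_convex V ->
  (forall n k, sqnorm_gap (u n) (u k) <= harmonic n + harmonic k) ->
  forall e : R, 0 < e -> exists N, forall n m, (N <= n)%N -> (N <= m)%N ->
    `|u n - u m| < e.
Proof.
move=> ucV gapu e e0.
have harm1 n : harmonic n <= 1 :> R.
  by rewrite /harmonic invf_le1// ler1n.
(* The defect against the first term is at most 2, so the norms differ by at most 2 sqrt 2 < 3. *)
have uM n : `|u n| <= `|u 0%N| + 3.
  have := sqnorm_gap_ge (u n) (u 0%N); have := gapu n 0%N.
  have := harm1 n; have := harm1 0%N => *.
  rewrite leNgt; apply/negP => ?.
  by nra.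
have [d d0 ucd] := uniformly_convex_sqnorm (`|u 0%N| + 3) ucV e0.
have /(cvgr_lt _ (@cvg_harmonic R))[N _ hN] : 0 < d / 2 by lra.
exists N => n m Nn Nm; apply: ucd => //.
have hn : harmonic n < d / 2 := hN _ Nn.
have hm : harmonic m < d / 2 := hN _ Nm.
by have := gapu n m; lra.
Qed.

(** * Minima of quadratic costs over closed midpoint-convex sets *)

Section quadratic_minimum.
Variables (R : realType) (E1 E2 : normedModType R).
Variable C : E1 -> E2 -> R -> Prop.

Definition quadratic_cost (a : E1) (b : E2) (r : R) : R :=
  (`|a| ^+ 2 + `|b| ^+ 2) / 2 - r.

(** The midpoint of two near-minimizers costs at least the infimum, and [r] is averaged exactly; so
    the excess costs bound the defects, and the first two components are Cauchy. *)
Lemma quadratic_minimum :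
  uniformly_convex E1 -> uniformly_convex E2 ->
  cauchy_cvg_seq E1 -> cauchy_cvg_seq E2 ->
  (exists a b r, C a b r) ->
  (forall a b r a' b' r', C a b r -> C a' b' r' ->
    C (2^-1 *: (a + a')) (2^-1 *: (b + b')) ((r + r') / 2)) ->
  (forall (a : nat -> E1) (b : nat -> E2) (r : nat -> R) a0 b0 r0,
    (forall n, C (a n) (b n) (r n)) ->
    a n @[n --> \oo] --> a0 -> b n @[n --> \oo] --> b0 ->
    r n @[n --> \oo] --> r0 -> C a0 b0 r0) ->
  (exists m, forall a b r, C a b r -> m <= quadratic_cost a b r) ->
  exists a b r, C a b r /\
    forall a' b' r', C a' b' r' ->
      quadratic_cost a b r <= quadratic_cost a' b' r'.
Proof.
move=> uc1 uc2 cv1 cv2 [a1 [b1 [r1 C1]]] Cmid Cclosed [m0 m0le].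
pose S := [set s | exists a b r, C a b r /\ s = quadratic_cost a b r].
have lS : has_lbound S by exists m0 => _ [a [b [r [Cabr ->]]]]; exact: m0le.
have S0 : S !=set0 by exists (quadratic_cost a1 b1 r1), a1, b1, r1.
pose m := inf S.
have mle a b r : C a b r -> m <= quadratic_cost a b r.
  by move=> Cabr; apply: ge_inf => //; exists a, b, r.
have /choice[c cP] n : exists c : E1 * E2 * R, C c.1.1 c.1.2 c.2 /\
    quadratic_cost c.1.1 c.1.2 c.2 <= m + harmonic n.
  have [_ [a [b [r [Cabr ->]]]] /ltW lt] :=
    inf_adherent (harmonic_gt0 n) (conj S0 lS).
  by exists (a, b, r).
have gap n k : sqnorm_gap (c n).1.1 (c k).1.1 +
    sqnorm_gap (c n).1.2 (c k).1.2 <= harmonic n + harmonic k.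
  have [Cn mn] := cP n; have [Ck mk] := cP k.
  have := mle _ _ _ (Cmid _ _ _ _ _ _ Cn Ck); move: mn mk.
  by rewrite /sqnorm_gap /quadratic_cost; lra.
have /(sqnorm_gap_cauchy uc1)/cv1[a ca] n k :
    sqnorm_gap (c n).1.1 (c k).1.1 <= harmonic n + harmonic k.
  by apply: le_trans (gap n k); rewrite lerDl sqnorm_gap_ge0.
have /(sqnorm_gap_cauchy uc2)/cv2[b cb] n k :
    sqnorm_gap (c n).1.2 (c k).1.2 <= harmonic n + harmonic k.
  by apply: le_trans (gap n k); rewrite lerDr sqnorm_gap_ge0.
(* The costs tend to [m], which determines the limit of the third components. *)
pose r := (`|a| ^+ 2 + `|b| ^+ 2) / 2 - m.
have cost_cvg : quadratic_cost (c n).1.1 (c n).1.2 (c n).2 @[n --> \oo] --> m.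
  apply: (@squeeze_cvgr _ _ _ _ (cst m) (fun n => m + harmonic n)).
  - by apply: nearW => n; have [Cn ->] := cP n; rewrite andbT; exact: mle.
  - exact: cvg_cst.
  - by rewrite -[X in _ --> X]addr0; apply: cvgD (cvg_cst _) cvg_harmonic.
have cr : (c n).2 @[n --> \oo] --> r.
  rewrite (_ : (fun n => _) = fun n => (`|(c n).1.1| ^+ 2 + `|(c n).1.2| ^+ 2) / 2
      - quadratic_cost (c n).1.1 (c n).1.2 (c n).2); last first.
    by apply/funext => n; rewrite /quadratic_cost; ring.
  apply: cvgB => //; apply: cvgMr_tmp; apply: cvgD.
    by apply: cvgM; exact: cvg_norm.
  by apply: cvgM; exact: cvg_norm.
exists a, b, r; split.
  by apply: Cclosed ca cb cr => n; exact: (cP n).1.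
move=> a' b' r' /mle; apply: le_trans; rewrite /quadratic_cost /r; lra.
Qed.

End quadratic_minimum.

(** The element minimizes |y|^2 - 2 f y. The minimum is -|f|^2, and f a <= |f| |a| then forces |a| =
    |f|. *)
Lemma norming_element (R : realType) (X : completeNormedModType R)
    (f : dual X) : uniformly_convex X ->
  exists x : X, f x = `|f| ^+ 2 :> R /\ `|x| = `|f|.
Proof.
move=> ucX; have [f0|f0] := eqVneq `|f| 0.
  by exists 0; rewrite f0 linear0 normr0 expr0n.
(* On the diagonal set [C] below, the quadratic cost is |a|^2 - 2 f a. *)
have {}f0 : 0 < `|f| by rewrite lt_def f0/=.
pose C (a b : X) (r : R) := a = b /\ r = 2 * f a.
have [|||a b r a' b' r'|a b r a0 b0 r0 Cn ca cb cr||a [b [r [[<- ->]]]] amin] :=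
  @quadratic_minimum R X X C ucX ucX.
- exact: complete_cauchy_cvg.
- exact: complete_cauchy_cvg.
- by exists 0, 0, (2 * f 0).
- by move=> [-> ->] [-> ->]; split=> //; rewrite !dualE; lra.
- split.
    have ab : a = b by apply/funext => n; exact: (Cn n).1.
    by move: cb; rewrite -ab; exact: (@cvg_unique _ (@norm_hausdorff _ X)) ca.
  have rE : r = fun n => 2 * f (a n) by apply/funext => n; exact: (Cn n).2.
  move: cr; rewrite rE => cr.
  apply: (@cvg_unique _ (@Rhausdorff R)) cr _.
  by apply: cvgMl_tmp; apply: continuous_cvg => //; exact: dual_continuous.
- exists (- `|f| ^+ 2) => x y _ [<- ->]; rewrite /quadratic_cost.
  by have := ler_dual f x; have := sqr_ge0 (`|x| - `|f|); nra.
have {}amin y : `|a| ^+ 2 - 2 * f a <= `|y| ^+ 2 - 2 * f y.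
  by have := amin y y (2 * f y) (conj erefl erefl); rewrite /quadratic_cost; lra.
(* The competitors are |f| u with [u] in the unit ball; the supremum over [u] produces the dual
   norm. *)
have fa : `|f| ^+ 2 <= 2 * f a - `|a| ^+ 2.
  have fu u : `|u| <= 1 ->
      f u <= (`|f| ^+ 2 + (2 * f a - `|a| ^+ 2)) / (2 * `|f|).
    move=> u1; rewrite ler_pdivlMr ?mulr_gt0//.
    have := amin (`|f| *: u); rewrite normrZ normr_id dualZ.
    have : (`|f| * `|u|) ^+ 2 <= `|f| ^+ 2.
      by rewrite lerXn2r ?nnegrE ?mulr_ge0// ler_piMr.
    by lra.
  have : `|f| <= (`|f| ^+ 2 + (2 * f a - `|a| ^+ 2)) / (2 * `|f|).
    apply: dual_norm_le => u u1; rewrite ler_norml fu// andbT lerNl -dualN.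
    by rewrite fu// normrN.
  by rewrite ler_pdivlMr ?mulr_gt0//; lra.
have fa' := ler_dual f a.
have na : `|a| = `|f|.
  apply/eqP; rewrite -subr_eq0 -sqrf_eq0; apply/eqP/le_anti.
  by rewrite sqr_ge0 andbT; nra.
by exists a; split=> //; move: fa fa'; rewrite na; lra.
Qed.

(** * Differentiability of the squared norm from uniform convexity of the paired space *)

Section smoothness.
Variables (R : realType) (E F : normedModType R) (B : E -> F -> R).
Hypothesis BDl : forall e e' f, B (e + e') f = B e f + B e' f.
Hypothesis BZl : forall a e f, B (a *: e) f = a * B e f.
Hypothesis BDr : forall e f f', B e (f + f') = B e f + B e f'.
Hypothesis BZr : forall a e f, B e (a *: f) = a * B e f.
Hypothesis B_le : forall e f, B e f <= `|e| * `|f|.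
Hypothesis norming : forall e, exists f, B e f = `|e| ^+ 2 /\ `|f| = `|e|.
Hypothesis ucF : uniformly_convex F.

(** The abstract pairing covers both X with X* and X* with X. If [g] norms [e + s *: d], then |e + s
    d|^2 / 2 <= |e|^2 / 2 + s B d g. The defect of [f] and [g] is of order [s], so uniform convexity
    of [F] lets [f] replace [g] up to [eps]. *)
Lemma sqnorm_smooth (e d : E) (f : F) (eps : R) :
  B e f = `|e| ^+ 2 -> `|f| = `|e| -> 0 < eps ->
  exists2 s0 : R, 0 < s0 & forall s, 0 < s < s0 ->
    `|e + s *: d| ^+ 2 / 2 <= `|e| ^+ 2 / 2 + s * B d f + s * eps.
Proof.
move=> Bef nf eps0.
pose eta := eps / (`|d| + 1).
have d1 : 0 < `|d| + 1 by rewrite ltr_wpDl.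
have eta0 : 0 < eta by rewrite divr_gt0.
have [del del0 ucd] := uniformly_convex_sqnorm `|e| ucF eta0.
(* [s * K] will bound the defect of [f] and [g]. *)
pose K := `|d| * (2 * `|e| + 2 * `|d|).
have K0 : 0 <= K by rewrite mulr_ge0// addr_ge0// mulr_ge0.
exists (Num.min 1 (del / (K + 1))).
  by rewrite lt_min ltr01 divr_gt0// ltr_wpDl.
move=> s /andP[s0]; rewrite lt_min => /andP[s1 sdel].
have [g [Bg ng]] := norming (e + s *: d).
have sK : s * K < del.
  by move: sdel; rewrite ltr_pdivlMr ?ltr_wpDl//; nra.
move: Bg; rewrite BDl BZl => Bg.
have ng1 : `|g| <= `|e| + s * `|d|.
  by rewrite ng (le_trans (ler_normD _ _))// normrZ gtr0_norm.
have ng2 : `|e| - s * `|d| <= `|g|.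
  rewrite ng lerBlDr; have := ler_normB (e + s *: d) (s *: d).
  by rewrite addrK normrZ gtr0_norm.
have Bdg := B_le d g; have Beg := B_le e g.
have sd : s * `|d| <= `|d| by rewrite ler_piMl// ltW.
have gap : sqnorm_gap f g < del.
  have mid := B_le e (2^-1 *: (f + g)); rewrite BZr BDr Bef in mid.
  rewrite /sqnorm_gap nf; set m := `|_ *: _| in mid *.
  have m1 : `|e| ^+ 2 + B e g - `|e| ^+ 2 <= m ^+ 2.
    by have := sqr_ge0 (m - `|e|); nra.
  have Bdg' : s * B d g <= s * `|d| * (`|e| + `|d|).
    rewrite -mulrA ler_wpM2l ?(ltW s0)//; apply: (le_trans Bdg).
    by rewrite ler_wpM2l//; lra.
  have diff : (`|e| ^+ 2 - `|g| ^+ 2) / 2 <= s * `|d| * (`|e| + `|d|).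
    have g0 := normr_ge0 g; have e0 := normr_ge0 e.
    have sd0 : 0 <= s * `|d| by rewrite mulr_ge0// ltW.
    have [ge|eg] := leP `|e| `|g|.
      have : 0 <= s * `|d| * (`|e| + `|d|) by rewrite mulr_ge0// addr_ge0.
      by nra.
    have -> : `|e| ^+ 2 - `|g| ^+ 2 = (`|e| - `|g|) * (`|e| + `|g|) by ring.
    have : (`|e| - `|g|) * (`|e| + `|g|) <= (s * `|d|) * (2 * (`|e| + `|d|)).
      by apply: ler_pM; have := normr_ge0 d; lra.
    by lra.
  rewrite -ng in Bg; move: sK; rewrite /K; lra.
have fg : `|f - g| < eta by apply: ucd => //; rewrite nf.
have BdN : B d (g - f) = B d g - B d f.
  by rewrite BDr -scaleN1r BZr mulN1r.
have Bdgf : B d g <= B d f + eps.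
  have := B_le d (g - f); rewrite BdN distrC.
  have : `|d| * `|f - g| <= eps.
    have : `|d| * `|f - g| <= (`|d| + 1) * eta.
      by apply: ler_pM => //; [lra|exact: ltW].
    by rewrite /eta mulrCA mulfV ?gt_eqF// mulr1.
  by lra.
have : s * B d g <= s * (B d f + eps) by rewrite ler_wpM2l// ltW.
rewrite -ng in Bg *; have := sqr_ge0 (`|e| - `|g|); nra.
Qed.

End smoothness.

(** * Minty's theorem *)

Lemma cvg_dual_apply (R : realType) (X : normedModType R) (T : Type)
    (F : set_system T) (FF : Filter F) (u : T -> dual X) (f : dual X) (x : X) :
  u n @[n --> F] --> f -> (u n x : R) @[n --> F] --> (f x : R).
Proof.
move=> uf; apply/cvgrPdist_lt => e e0.
have x1 : 0 < `|x| + 1 by rewrite ltr_wpDl.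
have /cvgrPdist_lt/(_ _ (divr_gt0 e0 x1)) := uf.
apply: filterS => n; rewrite ltr_pdivlMr// => fu.
rewrite -dual_oppE -dual_addE (le_lt_trans (ler_dual_norm _ _))//.
by apply: le_lt_trans fu; rewrite ler_wpM2l// lerDl.
Qed.

Section minty.
Variables (R : realType) (X : completeNormedModType R).
Hypotheses (ucX : uniformly_convex X) (ucX' : uniformly_convex (dual X)).
Variable G : X -> set (dual X).
Hypothesis G_mono : monotone_op G.
Hypothesis G_max : forall x xs,
  (forall y ys, G y ys -> 0 <= (xs - ys) (x - y)) -> G x xs.

(* The generators of the graph are the triples (y, g, - g y), and two triples are
   compatible if r + r' + f a' + f' a <= 0. [C1] is the set of triples compatible
   with all generators and [C] the set of those compatible with all of [C1]: by
   monotonicity [C] contains the generators and is included in [C1], so that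
   r + f a <= 0 on [C]. *)
Let C1 (a : X) (f : dual X) (r : R) :=
  forall y g, G y g -> r - g y + f y + g a <= 0.

Let C (a : X) (f : dual X) (r : R) :=
  forall a' f' r', C1 a' f' r' -> r + r' + f a' + f' a <= 0.

Let G_C1 y g : G y g -> C1 y g (- g y).
Proof. by move=> Gy z h /(G_mono Gy); rewrite !dualE; lra. Qed.

Let G_C y g : G y g -> C y g (- g y).
Proof. by move=> Gy a f r /(_ _ _ Gy); lra. Qed.

Let C_C1 a f r : C a f r -> C1 a f r.
Proof. by move=> Ca y g /G_C1/Ca; lra. Qed.

Let C_diag a f r : C a f r -> r + f a <= 0.
Proof. by move=> Ca; have := Ca _ _ _ (C_C1 Ca); lra. Qed.

Let C_conv (s : R) a f r a' f' r' : 0 <= s <= 1 -> C a f r -> C a' f' r' ->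
  C (a + s *: (a' - a)) (f + s *: (f' - f)) (r + s * (r' - r)).
Proof.
move=> /andP[s0 s1] Ca Ca' b g t Cb; have := Ca _ _ _ Cb; have := Ca' _ _ _ Cb.
rewrite !dualE; set u := (X in X <= 0); set v := (X in _ -> X <= 0 -> _).
move=> u0 v0; rewrite (_ : _ + _ = (1 - s) * v + s * u); last first.
  by rewrite /u /v; ring.
by rewrite -oppr_ge0; nra.
Qed.

Let C_closed (a : nat -> X) (f : nat -> dual X) (r : nat -> R) a0 f0 r0 :
  (forall n, C (a n) (f n) (r n)) ->
  a n @[n --> \oo] --> a0 -> f n @[n --> \oo] --> f0 -> r n @[n --> \oo] --> r0 ->
  C a0 f0 r0.
Proof.
move=> Cn ca cf cr b g t Cb.
have cv : (r n + t + f n b + g (a n) : R) @[n --> \oo] -->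
    (r0 + t + f0 b + g a0 : R).
  apply: cvgD; last by apply: continuous_cvg => //; exact: dual_continuous.
  apply: cvgD; last exact: cvg_dual_apply.
  by apply: cvgD => //; exact: cvg_cst.
by apply: (cvgr_to_le cv); apply: nearW => n; exact: Cn.
Qed.

(** [C1] and [C] encode, with [- r] as the value, the epigraphs of the Fitzpatrick function of [G]
    and of its conjugate; the cost adds half the squared norms to the latter. *)
Lemma minty : (exists y g, G y g) ->
  exists (p : X) (g : dual X), G p g /\ (`|p| ^+ 2 + `|g| ^+ 2) / 2 + g p <= 0.
Proof.
move=> [y0 [g0 Gy0]].
have [||||||a [f [r [Ca amin]]]] := @quadratic_minimum R X (dual X) C ucX ucX'.
- exact: complete_cauchy_cvg.
- exact: dual_cauchy_cvg.
- by exists y0, g0, (- g0 y0); exact: G_C.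
- move=> b g r b' g' r' Cb Cb'.
  have := @C_conv 2^-1 _ _ _ _ _ _ _ Cb Cb'.
  have mid (V : lmodType R) (u v : V) : u + 2^-1 *: (v - u) = 2^-1 *: (u + v).
    rewrite scalerBr scalerDr addrCA addrC; congr (_ + _).
    by rewrite -{1}[u]scale1r -scalerBl; congr (_ *: _); lra.
  rewrite (mid X) (mid (dual X)) (_ : r + _ = (r + r') / 2);
    last by lra.
  by apply; lra.
- exact: C_closed.
(* Since r <= - f a on [C], the cost is at least (|a| - |f|)^2 / 2. *)
- exists 0 => b g t /C_diag; rewrite /quadratic_cost.
  by have := ger_dual g b; have := sqr_ge0 (`|b| - `|g|); nra.
have [j [ja nj]] := norming_functional a.
have [x [fx nx]] := norming_element f ucX.
(* First-order condition along the segment towards (a', f', r'): [j] and [x] are the derivatives of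
   half the squared norms at [a] and [f], each used up to [eps / 2]. *)
have opt a' f' r' : C a' f' r' -> r' - r <= j (a' - a) + (f' - f) x.
  move=> Ca'; apply/ler_addgt0Pr => eps eps0.
  have eps2 : 0 < eps / 2 by lra.
  have ler_dualC u (h : dual X) : h u <= `|u| * `|h|.
    by rewrite mulrC; exact: ler_dual.
  have [s1 s10 H1] := @sqnorm_smooth R X (dual X) (fun u h => h u)
    (fun u v h => dualD h u v) (fun c u h => dualZ c h u)
    (fun u h h' => dual_addE h h' u) (fun c u h => dual_scaleE c h u)
    ler_dualC
    (@norming_functional R X) ucX' a (a' - a) j _ ja nj eps2.
  have [s2 s20 H2] := @sqnorm_smooth R (dual X) X (fun h u => h u)
    (fun h h' u => dual_addE h h' u) (fun c h u => dual_scaleE c h u)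
    (fun h u v => dualD h u v) (fun c h u => dualZ c h u)
    (@ler_dual R X) (fun h => norming_element h ucX) ucX
    f (f' - f) x _ fx nx eps2.
  have [s [s0 sl sl1 sl2]] : exists s : R, [/\ 0 < s, s <= 1, s < s1 & s < s2].
    have m0 : 0 < Num.min 1 (Num.min s1 s2) by rewrite !lt_min ltr01 s10.
    have : Num.min 1 (Num.min s1 s2) / 2 < Num.min 1 (Num.min s1 s2) by lra.
    rewrite lt_min lt_min => /and3P[sl sl1 sl2].
    by exists (Num.min 1 (Num.min s1 s2) / 2); split=> //; [lra|exact: ltW].
  have /H1 h1 : 0 < s < s1 by rewrite s0.
  have /H2 h2 : 0 < s < s2 by rewrite s0.
  have s01 : 0 <= s <= 1 by rewrite (ltW s0).
  have := amin _ _ _ (C_conv s01 Ca Ca'); rewrite /quadratic_cost => h3.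
  by rewrite -(ler_pM2l s0); cbv beta in h1, h2; move: h1 h2 h3; lra.
have fa := C_diag Ca; have fa_ge := ger_dual f a; have jx_ge := ger_dual j x.
have sq := sqr_ge0 (`|a| - `|f|).
rewrite nj nx in jx_ge.
(* The condition at a generator; its left side is at least (|a| - |f|)^2. *)
have rel y g : G y g ->
    j x - r + `|a| ^+ 2 + `|f| ^+ 2 <= (- j - g) (- x - y).
  by move=> /G_C/opt; rewrite !dualE ja fx; lra.
have Gb : G (- x) (- j).
  apply: G_max => y g /rel; apply: le_trans; move: sq fa_ge fa jx_ge; nra.
(* At the pair (- x, - j) itself the right side of [rel] vanishes. *)
exists (- x), (- j); split=> //; have := rel _ _ Gb.
rewrite !dualE !normrN nx nj; move: sq fa_ge fa jx_ge; nra.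
Qed.

End minty.

(** * Faces and upper limits of maximal monotone operators *)

Section maximal_monotone_theory.
Variables (R : realType) (X : normedModType R).
Implicit Types (A : X -> set (dual X)) (x v : X) (f : dual X).

(** Otherwise adjoining (x, f) would properly enlarge the graph and keep it monotone. *)
Lemma maximal_monotone_related A x f : maximal_monotone A ->
  (forall y g, A y g -> 0 <= (f - g) (x - y)) -> A x f.
Proof.
move=> [Amono Amax] rel; apply: contrapT => nAxf.
pose A' y := A y `|` [set g | y = x /\ g = f].
apply: (Amax A') => [y z g h [Ay|[-> ->]] [Az|[-> ->]]|].
- exact: Amono.
- by have := rel _ _ Ay; rewrite !dualE; lra.
- exact: rel.
- by rewrite !dualE; lra.
by split=> [[y g] Ayg|AA']; [left|apply: nAxf; apply: (AA' (x, f)); right].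
Qed.

Lemma cvg_pairing (F : set_system nat) (FF : Filter F) (u : nat -> dual X)
    (z : nat -> X) f x (K : R) :
  (forall n, `|u n| <= K) -> (u n x : R) @[n --> F] --> (f x : R) ->
  z n @[n --> F] --> x -> (u n (z n) : R) @[n --> F] --> (f x : R).
Proof.
move=> uK uf zx.
have cv0 : (u n (z n - x) : R) @[n --> F] --> (0 : R).
  apply/cvgr0Pnorm_lt => e e0.
  have K1 : 0 < `|K| + 1 by rewrite ltr_wpDl.
  have /cvgrPdist_lt/(_ _ (divr_gt0 e0 K1)) := zx.
  apply: filterS => n; rewrite ltr_pdivlMr// distrC => zn.
  apply: (le_lt_trans (ler_dual_norm _ _)); apply: le_lt_trans zn.
  rewrite mulrC ler_wpM2l//; have := uK n; have := ler_norm K; lra.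
rewrite (_ : (fun n => _) = fun n => (u n (z n - x) : R) + u n x).
  by rewrite -[X in _ --> X]add0r; exact: cvgD.
by apply/funext => n; rewrite !dualE subrK.
Qed.

(** Pairings converge under norm convergence of the points and bounded weak-* convergence of the
    functionals. The filter is general because limits along ultrafilters also occur. *)
Lemma maximal_monotone_closed A (F : set_system nat) (FF : ProperFilter F)
    (u : nat -> dual X) (z : nat -> X) f x (K : R) :
  maximal_monotone A -> (forall n, A (z n) (u n)) -> (forall n, `|u n| <= K) ->
  (forall y, (u n y : R) @[n --> F] --> (f y : R)) -> z n @[n --> F] --> x ->
  A x f.
Proof.
move=> maxA Azu uK uf zx; apply: maximal_monotone_related => // y g Ayg.
have cv : (u n (z n) - u n y - (g (z n) - g y) : R) @[n --> F] -->
    (f x - f y - (g x - g y) : R).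
  apply: cvgB; first by apply: cvgB => //; exact: cvg_pairing (uf x) zx.
  apply: cvgB; last exact: cvg_cst.
  by apply: continuous_cvg => //; exact: dual_continuous.
have -> : (f - g) (x - y) = f x - f y - (g x - g y) :> R by rewrite !dualE; ring.
apply: (cvgr_to_ge cv); apply: nearW => n.
by have := maxA.1 _ _ _ _ (Azu n) Ayg; rewrite !dualE; lra.
Qed.

Lemma face_max A x v f : face A x v f -> forall g, A x g -> g v <= f v :> R.
Proof.
move=> [_ fE] g Axg; rewrite -lee_fin fE; apply: ereal_sup_ubound.
by exists g.
Qed.

Lemma face_of_max A x v f : A x f -> (forall g, A x g -> g v <= f v :> R) ->
  face A x v f.
Proof.
move=> Axf fmax; split=> //; apply/eqP; rewrite eq_le; apply/andP; split.
  by apply: ereal_sup_ubound; exists f.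
by apply: ge_ereal_sup => _ [g Axg <-]; rewrite lee_fin; exact: fmax.
Qed.

Lemma cvg_weak_cvg (V : normedModType R) (u : nat -> V) (l : V) :
  u n @[n --> \oo] --> l -> weak_cvg u l.
Proof.
by move=> ul h; apply: continuous_cvg => //; exact: dual_continuous.
Qed.

(** Evaluation at [x] is an element of the bidual. *)
Lemma weak_cvg_apply (u : nat -> dual X) f : weak_cvg u f ->
  forall x, (u n x : R) @[n --> \oo] --> (f x : R).
Proof.
move=> uf x.
have [||g|ev evE _] := @dual_of_bounded R (dual X) (fun g => g x) `|x|.
- by [].
- by [].
- by rewrite mulrC; exact: ler_dual_norm.
have : (ev : dual X -> R) (u n) @[n --> \oo] --> (ev : dual X -> R) f := uf ev.
by rewrite evE.
Qed.

End maximal_monotone_theory.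

Lemma weak_cvg_bounded (R : realType) (X : completeNormedModType R)
    (u : nat -> dual X) (f : dual X) : weak_cvg u f ->
  exists K : R, forall n, `|u n| <= K.
Proof.
move=> /weak_cvg_apply uf.
have [|x|K uK] :=
  @Banach_Steinhauss R X R^o (range (fun n => u n : X -> R^o)) _ _ 1.
- move=> _ [n _ <-]; split; last exact: dual_linear.
  move=> r; exists (`|u n| * r) => x xr.
  by rewrite (le_trans (ler_dual_norm _ _))// ler_wpM2l.
- have /cvgP/cvg_seq_bounded[M [_ uM]] := uf x.
  by exists (M + 1) => _ [n _ <-]; apply: uM => //; rewrite ltrDl.
exists K => n; apply: dual_norm_le => x x1.
by apply: uK => //; exists n.
Qed.

(** * The cycle of inclusions between the face and the two upper limits *)

Section limsup.
Variables (R : realType) (X : completeNormedModType R).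
Variable A : X -> set (dual X).
Hypothesis maxA : maximal_monotone A.
Implicit Types x v : X.

(** Monotonicity against (x, g), divided by [t n], gives g (w n) <= u n (w n), which passes to the
    limit. *)
Lemma wLimsup_op_face x v : wLimsup_op A x v `<=` face A x v.
Proof.
move=> f [w [t [u [wv [t0 tcv] uf Au]]]].
have [K uK] := weak_cvg_bounded uf; have uf' := weak_cvg_apply uf.
have zx : x + t n *: w n @[n --> \oo] --> x.
  rewrite -[X in _ --> X]addr0 -(scale0r v); apply: cvgD; first exact: cvg_cst.
  exact: cvgZ.
have Axf : A x f by apply: maximal_monotone_closed maxA Au uK uf' zx.
apply: face_of_max => // g Axg.
have cvu : (u n (w n) : R) @[n --> \oo] --> (f v : R).
  exact: cvg_pairing (uf' v) wv.
have cvg_ : (g (w n) : R) @[n --> \oo] --> (g v : R).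
  by apply: continuous_cvg => //; exact: dual_continuous.
apply: (ler_cvg_to cvg_ cvu); apply: nearW => n.
have := maxA.1 _ _ _ _ (Au n) Axg.
rewrite [x + _ - x]addrC addKr dualZ pmulr_rge0//.
by rewrite !dualE subr_ge0.
Qed.

Lemma resolvent_direction (t : R) x v f :
  uniformly_convex X -> uniformly_convex (dual X) -> 0 < t -> A x f ->
  exists p : X * dual X, A (x + t *: (v + p.1)) (f + p.2) /\
    (`|p.1| ^+ 2 + `|p.2| ^+ 2) / 2 <= p.2 v :> R.
Proof.
move=> ucX ucX' t0 Axf.
pose G y := [set g | A (x + t *: (v + y)) (f + g)].
have shift y z : x + t *: (v + y) - (x + t *: (v + z)) = t *: (y - z).
  by rewrite opprD addrACA subrr add0r -scalerBr opprD addrACA subrr add0r.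
have Gmono : monotone_op G.
  move=> y z g h Gy Gz; have := maxA.1 _ _ _ _ Gy Gz.
  by rewrite shift opprD addrACA subrr add0r dualZ pmulr_rge0.
have Gmax y g : (forall z h, G z h -> 0 <= (g - h) (y - z)) -> G y g.
  move=> rel; apply: (maximal_monotone_related maxA) => z h Azh.
  (* This inverts the change of variable y |-> x + t (v + y). *)
  pose z' := t^-1 *: (z - x) - v.
  have zE : z = x + t *: (v + z').
    rewrite /z' [v + _]addrC subrK scalerA mulfV ?gt_eqF// scale1r.
    by rewrite [x + _]addrC subrK.
  have /rel : G z' (h - f) by rewrite /G/= -zE [f + _]addrC subrK.
  by rewrite {1}zE shift dualZ pmulr_rge0// !dualE; lra.
(* The point [- v] corresponds to [x], where [f] is a value of [A]. *)
have G0 : exists y g, G y g.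
  by exists (- v), 0; rewrite /G/= subrr scaler0 !addr0.
have [p [g [Gp pg]]] := minty ucX ucX' Gmono Gmax G0.
exists (p, g); split=> //=.
have := maxA.1 _ _ _ _ Gp Axf.
rewrite [x + _ - x]addrC addKr [f + _ - f]addrC addKr dualZ pmulr_rge0// dualD.
lra.
Qed.

Lemma face_Limsup_op x v : uniformly_convex X -> uniformly_convex (dual X) ->
  face A x v `<=` Limsup_op A x v.
Proof.
move=> ucX ucX' f xvf; have fmax := face_max xvf; case: xvf => Axf _.
pose t n : R := harmonic n.
have t0 n : 0 < t n by exact: harmonic_gt0.
have [p pP] := choice (fun n => resolvent_direction v ucX ucX' (t0 n) Axf).
(* With g = [(p n).2], one has |g|^2 / 2 <= <g, v> <= |g| |v|. *)
have p2_le n : `|(p n).2| <= 2 * `|v|.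
  have := (pP n).2; have := ler_dual (p n).2 v; have := sqr_ge0 `|(p n).1|.
  have := normr_ge0 v => *; rewrite leNgt; apply/negP => ?; nra.
have p1_le n : `|(p n).1| <= 2 * `|v|.
  have := (pP n).2; have := ler_dual (p n).2 v; have := p2_le n.
  have := normr_ge0 (p n).2; have := normr_ge0 v.
  move=> *; rewrite leNgt; apply/negP => ?; nra.
have zx : x + t n *: (v + (p n).1) @[n --> \oo] --> x.
  apply/cvgrPdist_lt => e e0.
  have K0 : 0 < 3 * `|v| + 1 by rewrite ltr_wpDl// mulr_ge0.
  have tlt : \forall n \near \oo, t n < e / (3 * `|v| + 1).
    exact: cvgr_lt (@cvg_harmonic R) _ (divr_gt0 e0 K0).
  apply: filterS tlt => n; rewrite ltr_pdivlMr// => te.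
  rewrite opprD addNKr normrN normrZ gtr0_norm//.
  apply: le_lt_trans te; rewrite ler_wpM2l ?(ltW (t0 n))//.
  by have := ler_normD v (p n).1; have := p1_le n; lra.
(* Otherwise the indices with [(p n).2 v] above [e] carry a proper filter. A weak-* cluster point
   [g] along it has g v >= e and f + g in A x, against the maximality of f v. *)
have small e : 0 < e -> \forall n \near \oo, ((p n).2 v : R) <= e.
  move=> e0; apply: contrapT => nsmall.
  pose F := within [set n | e < ((p n).2 v : R)] \oo.
  have PF : ProperFilter F.
    split; last exact: within_filter.
    move=> F0; apply: nsmall.
    have {}F0 : \forall n \near \oo, ~ e < ((p n).2 v : R) by exact: F0.
    by apply: filterS F0 => n /negP; rewrite -leNgt.
  have ooF : \oo `<=` F by move=> B; apply: filterS.
  have [U [g [PU FU gU]]] := weak_star_cluster PF p2_le.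
  have Axfg : A x (f + g).
    apply: (@maximal_monotone_closed _ _ A U PU (fun n => f + (p n).2)
      (fun n => x + t n *: (v + (p n).1)) _ _ (`|f| + 2 * `|v|)) => //.
    - by move=> n; exact: (pP n).1.
    - by move=> n; rewrite (le_trans (ler_normD _ _))// lerD2l.
    - by move=> y; apply: cvgD; [exact: cvg_cst|exact: gU].
    - by apply: cvg_trans zx => B nB; apply/FU/ooF.
  have := fmax _ Axfg; rewrite dual_addE.
  have : e <= g v.
    apply: (cvgr_to_ge (gU v)); apply: FU.
    by apply: filterS (withinT _ _) => n /ltW.
  by lra.
(* Half of each squared norm is separately at most [(p n).2 v], so this serves for both
   components. *)
have sq_small (V : normedModType R) (q : nat -> V) :
    (forall n, `|q n| ^+ 2 / 2 <= (p n).2 v) -> q n @[n --> \oo] --> 0.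
  move=> qp; apply/cvgr0Pnorm_le => e e0.
  have e2 : 0 < e ^+ 2 / 2 by rewrite divr_gt0// exprn_gt0.
  apply: filterS (small _ e2) => n pe.
  rewrite -(ler_pXn2r (_ : 0 < 2)%N) ?nnegrE ?(ltW e0)//.
  by have := qp n; lra.
exists (fun n => v + (p n).1), t, (fun n => f + (p n).2); split.
- rewrite -[X in _ --> X]addr0; apply: cvgD; first exact: cvg_cst.
  apply: sq_small => n; have := (pP n).2; have := sqr_ge0 `|(p n).2|; lra.
- by split=> //; exact: cvg_harmonic.
- rewrite -[X in _ --> X]addr0; apply: cvgD; first exact: cvg_cst.
  apply: sq_small => n; have := (pP n).2; have := sqr_ge0 `|(p n).1|; lra.
- by move=> n; exact: (pP n).1.
Qed.

Lemma Limsup_op_wLimsup_op x v : Limsup_op A x v `<=` wLimsup_op A x v.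
Proof.
move=> f [w [t [u [wv tcv uf Au]]]]; exists w, t, u; split=> //.
exact: cvg_weak_cvg.
Qed.

End limsup.

Theorem theorem3p1 (R : realType) (X : completeNormedModType R)
    (hX : uniformly_convex X) (hX' : uniformly_convex (dual X))
    (A : X -> set (dual X)) (hA : maximal_monotone A)
    (x : X) (hx : opdom A x) (v : X) (hv : v <> 0) :
  face A x v = Limsup_op A x v /\ Limsup_op A x v = wLimsup_op A x v.
Proof.
have face_sub := @face_Limsup_op R X A hA x v hX hX'.
have Lw := @Limsup_op_wLimsup_op R X A x v.
have w_face := @wLimsup_op_face R X A hA x v.
split; apply/seteqP; split=> // f Hf.
- exact/w_face/Lw.
- exact/face_sub/w_face.
Qed.
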